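(* Let $A\in\mathbb{C}^{N\times N}$ be a positive real matrix, i.e. $\mathrm{Re}(\mathbf{v}^H A\mathbf{v})>0$ for all $\mathbf{v}\in\mathbb{C}^N$, $\mathbf{v}\neq 0$, let $\mathbf{b}\in\mathbb{C}^N$, and let $f$ be a Stieltjes function, $f(z)=\int_0^\infty (t+z)^{-1}\,\mathrm{d}\mu(t)$. Let $\varepsilon\in[0,1)$ and let $S\in\mathbb{C}^{s\times N}$ satisfy $$(1-\varepsilon)\|\mathbf{v}\|^2\le \|S\mathbf{v}\|^2\le (1+\varepsilon)\|\mathbf{v}\|^2\qquad\text{for all } \mathbf{v}\in\mathcal{K}_{m+1}(A,\mathbf{b}).$$ Let $\widetilde{\mathbf{f}}_m$ be the sketched GMRES approximant to $f(A)\mathbf{b}$, i.e. $$\widetilde{\mathbf{f}}_m = V_m\int_0^\infty (tSV_m+SAV_m)^\dagger\,\mathrm{d}\mu(t)\,(S\mathbf{b}),$$ where the columns of $V_m\in\mathbb{C}^{N\times m}$ form a basis of $\mathcal{K}_m(A,\mathbf{b})$. Define $$\delta=\lambda_{\min}\Big(\frac{A+A^H}{2}\Big),\qquad \rho=\lambda_{\min}\Big(\frac{A^{-1}+A^{-H}}{2}\Big),\qquad \beta_0=\arccos(\delta/\|A\|)\in[0,\pi/2).$$ Then $$\|f(A)\mathbf{b}-\widetilde{\mathbf{f}}_m\|_{A^HA}\le C_1\,C_\varepsilon\,\|\mathbf{b}\|\,(\sin\beta_0)^m,$$ with constants $C_1=\|A\|\,f(\rho\|A\|^2)$ and $C_\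varepsilon=\sqrt{(1+\varepsilon)/(1-\varepsilon)}$.
   Context: $\|\cdot\|$ is the Euclidean vector norm and the induced spectral matrix norm; $^H$ is the conjugate transpose, $A^{-H}=(A^{-1})^H$; $^\dagger$ is the Moore--Penrose inverse; $\lambda_{\min}$ is the smallest eigenvalue of a Hermitian matrix. For a Hermitian positive definite matrix $M$, $\|\mathbf{v}\|_M:=\sqrt{\mathbf{v}^HM\mathbf{v}}$. The Krylov space is $\mathcal{K}_m(A,\mathbf{b})=\mathrm{span}\{\mathbf{b},A\mathbf{b},\dots,A^{m-1}\mathbf{b}\}$. A Stieltjes function is a function of the form $f(z)=\int_0^\infty (t+z)^{-1}\,\mathrm{d}\mu(t)$, where $\mu$ is monotonically increasing and nonnegative on $[0,\infty)$ with $\int_0^\infty (t+1)^{-1}\,\mathrm{d}\mu(t)<\infty$; correspondingly $f(A)\mathbf{b}=\int_0^\infty (tI+A)^{-1}\mathbf{b}\,\mathrm{d}\mu(t)$. The sketched GMRES approximant is obtained by replacing $(tI+A)^{-1}\mathbf{b}$ in this integral by $V_m\widetilde{\mathbf{y}}_m(t)$, where $\widetilde{\mathbf{y}}_m(t)=(tSV_m+SAV_m)^\dagger(S\mathbf{b})$ minimizes the sketched residual norm $\|S\mathbf{b}-S(tI+A)V_m\mathbf{y}\|$ over $\mathbf{y}\in\mathbb{C}^m$. *)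

(* Defs.v *)
From HB Require Import structures.
From mathcomp Require Import all_boot all_order all_algebra.
From mathcomp Require Import all_classical all_reals all_analysis.
From mathcomp Require Import complex.

Set Implicit Arguments.
Unset Strict Implicit.
Unset Printing Implicit Defensive.

Import Order.TTheory GRing.Theory Num.Theory.
Import numFieldNormedType.Exports.

Open Scope classical_set_scope.
Open Scope ring_scope.
Open Scope complex_scope.
Open Scope sesquilinear_scope.

Section LinearAlgebra.
Variable R : realType.
Local Notation C := R[i].

Definition enorm n (v : 'cV[C]_n) : R :=
  Num.sqrt (complex.Re ((v^t* *m v) 0 0)).

Definition wnorm n (M : 'M[C]_n) (v : 'cV[C]_n) : R :=
  Num.sqrt (complex.Re ((v^t* *m M *m v) 0 0)).

Definition specnorm m n (A : 'M[C]_(m, n)) : R :=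
  sup [set enorm (A *m v) | v in [set v : 'cV[C]_n | enorm v <= 1]].

Definition positive_real n (A : 'M[C]_n) : Prop :=
  forall v : 'cV[C]_n, v != 0 -> 0 < complex.Re ((v^t* *m A *m v) 0 0).

(* For Hermitian H of positive size all eigenvalues are real and this set is
   finite and nonempty, so that the infimum is a minimum. *)
Definition lambda_min n (H : 'M[C]_n) : R :=
  inf [set x : R | eigenvalue H x%:C].

Definition herm_part n (A : 'M[C]_n) : 'M[C]_n := 2^-1 *: (A + A^t*).

Definition moore_penrose m n (M : 'M[C]_(m, n)) (X : 'M[C]_(n, m)) : Prop :=
  [/\ M *m X *m M = M, X *m M *m X = X,
      (M *m X)^t* = M *m X & (X *m M)^t* = X *m M].

(* By Penrose's theorem every M has exactly one such X; the default value 0 of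
   the choice operator is never used. *)
Definition mpinv m n (M : 'M[C]_(m, n)) : 'M[C]_(n, m) :=
  xget 0 [set X | moore_penrose M X].

Definition krylov n (A : 'M[C]_n) (b : 'cV[C]_n) (m : nat) : {vspace 'cV[C]_n} :=
  <<[seq A ^+ k *m b | k <- iota 0 m]>>%VS.

End LinearAlgebra.

Section Stieltjes.
Variable R : realType.
Local Notation C := R[i].

Record stieltjes_weight := StieltjesWeight {
  weight :> R -> R;
  weight_ge0 : forall t, 0 <= t -> 0 <= weight t;
  weight_nd : forall s t, 0 <= s -> s <= t -> weight s <= weight t }.

Implicit Type mu : stieltjes_weight.

(* A monotone integrator need not be right-continuous, but Lebesgue-Stieltjes
   measures are built from right-continuous functions. The function below is
   mu(t+) for t >= 0 and mu 0 for t < 0 (see the two lemmas that follow), so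
   that its measure gives mass mu(d+) - mu(c-) to [c, d] if 0 < c <= d, and
   mass mu(d+) - mu 0 to [0, d]: a jump of mu at 0 is part of the integral
   over [0, +oo[. *)
Definition regularized mu (t : R) : R :=
  inf [set mu s | s in [set s | 0 <= s /\ t < s]].

Let image_lb mu t : has_inf [set mu s | s in [set s | 0 <= s /\ t < s]].
Proof.
split.
- exists (mu (`|t| + 1)), (`|t| + 1) => //; split; first by rewrite addr_ge0.
  by rewrite (le_lt_trans (ler_norm t))// ltrDl.
- by exists 0 => _ [s [s0 _] <-]; exact: weight_ge0.
Qed.

Let regularized_le mu t s : 0 <= s -> t < s -> regularized mu t <= mu s.
Proof. by move=> s0 ts; apply: ge_inf; [case: (image_lb mu t)|exists s]. Qed.

Let regularized_ge mu t x :
  (forall s, 0 <= s -> t < s -> x <= mu s) -> x <= regularized mu t.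
Proof.
move=> h; apply: lb_le_inf; first by case: (image_lb mu t).
by move=> _ [s [s0 ts] <-]; exact: h.
Qed.

Lemma regularized_lt0 mu t : t < 0 -> regularized mu t = mu 0.
Proof.
move=> t0; apply/eqP; rewrite eq_le regularized_le//=.
by apply: regularized_ge => s s0 _; exact: weight_nd.
Qed.

Let approx mu t e : 0 < e -> exists s, [/\ 0 <= s, t < s & mu s < regularized mu t + e].
Proof.
move=> e0; have [_ [s [s0 ts] <-] h] := inf_adherent e0 (image_lb mu t).
by exists s.
Qed.

Lemma regularized_cvg mu t : 0 <= t -> mu x @[x --> t^'+] --> regularized mu t.
Proof.
move=> t0; apply/cvgrPdist_lt => e e0.
have [s [s0 ts hs]] := approx mu t e0.
near=> x.
have tx : t < x by near: x; exact: nbhs_right_gt.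
have xs : x < s by near: x; exact: nbhs_right_lt.
have x0 : 0 <= x by rewrite (le_trans t0)// ltW.
rewrite distrC ger0_norm ?subr_ge0 ?regularized_le//.
by rewrite ltrBlDl (le_lt_trans (weight_nd mu x0 (ltW xs))).
Unshelve. all: by end_near. Qed.

Let regularized_nd mu : {homo regularized mu : s t / s <= t}.
Proof.
move=> s t st; apply: regularized_ge => u u0 tu.
by rewrite regularized_le// (le_lt_trans st).
Qed.

Let regularized_rc mu : right_continuous (regularized mu).
Proof.
move=> t; apply/cvgrPdist_lt => e e0.
have [s [s0 ts hs]] := approx mu t e0.
near=> x.
have tx : t < x by near: x; exact: nbhs_right_gt.
have xs : x < s by near: x; exact: nbhs_right_lt.
rewrite distrC ger0_norm ?subr_ge0 ?regularized_nd// ?ltW//.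
by rewrite ltrBlDl (le_lt_trans _ hs)// regularized_le.
Unshelve. all: by end_near. Qed.

HB.instance Definition _ mu := isCumulative.Build R _ R (regularized mu)
  (@regularized_nd mu) (@regularized_rc mu).

Definition stieltjes_measure mu :=
  lebesgue_stieltjes_measure (regularized mu).

Definition stieltjes_integrable mu : Prop :=
  (\int[stieltjes_measure mu]_(t in `[0%R, +oo[) ((t + 1)^-1)%:E < +oo)%E.

Definition cintegral mu (g : R -> C) : C :=
  Rintegral (stieltjes_measure mu) `[0%R, +oo[ (fun t => complex.Re (g t))
  +i* Rintegral (stieltjes_measure mu) `[0%R, +oo[ (fun t => complex.Im (g t)).

Definition mxintegral mu p q (G : R -> 'M[C]_(p, q)) : 'M[C]_(p, q) :=
  \matrix_(j, k) cintegral mu (fun t => G t j k).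

(* z <= 0 in R[i] means that z is real and nonpositive. *)
Definition stieltjes_function mu (f : C -> C) : Prop :=
  stieltjes_integrable mu /\
  forall z : C, ~~ (z <= 0) -> f z = cintegral mu (fun t => (t%:C + z)^-1).

Definition stieltjes_mx mu n (A : 'M[C]_n) (b : 'cV[C]_n) : 'cV[C]_n :=
  mxintegral mu (fun t => invmx (t%:C%:M + A) *m b).

Definition sketched_gmres mu n m s (A : 'M[C]_n) (b : 'cV[C]_n)
    (S : 'M[C]_(s, n)) (V : 'M[C]_(n, m)) : 'cV[C]_n :=
  V *m mxintegral mu (fun t => mpinv (t%:C *: (S *m V) + S *m A *m V))
    *m (S *m b).

End Stieltjes.

(* Main.v *)
(* For t >= 0 let e(t) be the error of the sketched GMRES iterate for the
   shifted system (t + A) x = b.  Since S is a near-isometry on K_{m+1}, the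
   residual is at most C_eps times that of any z in K_m; m Richardson steps with
   damping (t + delta) / (t + |A|)^2 give a z whose residual contracts by
   sqrt (1 - ((t + delta) / (t + |A|))^2) <= sin beta0 per step, which bounds it
   by |b| sin^m beta0.  The norm of A (t + A)^-1 is at most
   |A| / (t + rho |A|^2), and integrating this bound against mu gives
   |A| f(rho |A|^2).  All estimates use the real inner product Re (u^H v). *)

Require Import Defs.
From HB Require Import structures.
From mathcomp Require Import all_boot all_order all_algebra.
From mathcomp Require Import all_classical all_reals all_analysis.
From mathcomp Require Import complex.
From mathcomp Require Import measurable_realfun ring lra.

Import Order.TTheory GRing.Theory Num.Theory.
Import numFieldNormedType.Exports.

Local Open Scope ring_scope.
Local Open Scope complex_scope.
Local Open Scope sesquilinear_scope.

Set Implicit Arguments.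
Unset Strict Implicit.
Unset Printing Implicit Defensive.

Local Notation Re := complex.Re.
Local Notation Im := complex.Im.

(** * The real inner product on complex vectors *)

Section RealInnerProduct.
Variable R : realType.
Local Notation C := R[i].

(** The residual bound is uniform in [t], so the shift survives only in the factor
    [1 / (t + rho |A|^2)], whose integral is by definition a value of [f]; this is why
    [A (t + A)^-1] is bounded in exactly that form. The other obstacle is analytic. Integrals are
    taken entrywise, real and imaginary parts apart, and carry no information about a function that
    is not integrable. Hence [A] and [V] pass through the integral only once the resolvent and the
    sketched pseudoinverse are known to be integrable; both are dominated by a multiple of
    [1 / (t + 1)]. Since [mpinv] is a chosen matrix, its measurability in [t] is not visible. The
    embedding property of [S] makes [t S V + S A V] injective for every [t >= 0], and injectivity
    gives the closed form [(M^H M)^-1 M^H], whose entries are measurable. *)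

Lemma ReD (x y : C) : Re (x + y) = Re x + Re y.
Proof. by case: x y => [a b] [c d]. Qed.

Lemma ImD (x y : C) : Im (x + y) = Im x + Im y.
Proof. by case: x y => [a b] [c d]. Qed.

Lemma ReN (x : C) : Re (- x) = - Re x.
Proof. by case: x. Qed.

Lemma Re_sum I (r : seq I) (P : pred I) (F : I -> C) :
  Re (\sum_(i <- r | P i) F i) = \sum_(i <- r | P i) Re (F i).
Proof. exact: (big_morph _ ReD erefl). Qed.

Lemma ReM (x y : C) : Re (x * y) = Re x * Re y - Im x * Im y.
Proof. by case: x y => [a b] [c d]. Qed.

Lemma ImM (x y : C) : Im (x * y) = Re x * Im y + Im x * Re y.
Proof. by case: x y => [a b] [c d]. Qed.

(** The Euclidean inner product of [C^n] read as [R^(2n)]. Its symmetry turns every expanded square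
    into a real polynomial identity, and positive realness is a statement about it. *)
Definition rdot n (u v : 'cV[C]_n) : R := Re ((u^t* *m v) 0 0).

Lemma rdotE n (u v : 'cV[C]_n) :
  rdot u v = \sum_i (Re (u i 0) * Re (v i 0) + Im (u i 0) * Im (v i 0)).
Proof.
rewrite /rdot mxE Re_sum; apply: eq_bigr => i _.
by rewrite !mxE ReM; case: (u i 0) => a b /=; rewrite mulNr opprK.
Qed.

Lemma rdotC n (u v : 'cV[C]_n) : rdot u v = rdot v u.
Proof. by rewrite !rdotE; apply: eq_bigr => i _; rewrite mulrC [X in _ + X]mulrC. Qed.

Lemma rdotDr n (u v w : 'cV[C]_n) : rdot u (v + w) = rdot u v + rdot u w.
Proof. by rewrite /rdot mulmxDr mxE ReD. Qed.

Lemma rdotNr n (u v : 'cV[C]_n) : rdot u (- v) = - rdot u v.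
Proof. by rewrite /rdot mulmxN mxE ReN. Qed.

Lemma rdotZr n (u v : 'cV[C]_n) a : rdot u (a%:C *: v) = a * rdot u v.
Proof. by rewrite /rdot -scalemxAr mxE ReM /= mul0r subr0. Qed.

Lemma rdotDl n (u v w : 'cV[C]_n) : rdot (u + v) w = rdot u w + rdot v w.
Proof. by rewrite rdotC rdotDr !(rdotC w). Qed.

Lemma rdotNl n (u v : 'cV[C]_n) : rdot (- u) v = - rdot u v.
Proof. by rewrite rdotC rdotNr rdotC. Qed.

Lemma rdotZl n (u v : 'cV[C]_n) a : rdot (a%:C *: u) v = a * rdot u v.
Proof. by rewrite rdotC rdotZr rdotC. Qed.

Lemma rdot_adjr m n (M : 'M[C]_(m, n)) u v :
  rdot u (M *m v) = rdot (M^t* *m u) v.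
Proof. by rewrite /rdot trmx_mul map_mxM trmxCK mulmxA. Qed.

Lemma rdot_adjl m n (M : 'M[C]_(m, n)) u v :
  rdot (M *m u) v = rdot u (M^t* *m v).
Proof. by rewrite rdotC rdot_adjr rdotC. Qed.

Lemma rdot_ge0 n (v : 'cV[C]_n) : 0 <= rdot v v.
Proof.
by rewrite rdotE; apply: sumr_ge0 => i _; rewrite -!expr2 addr_ge0 ?sqr_ge0.
Qed.

Lemma rdot_eq0 n (v : 'cV[C]_n) : (rdot v v == 0) = (v == 0).
Proof.
apply/idP/eqP => [|->]; last by rewrite /rdot mulmx0 mxE.
rewrite rdotE psumr_eq0 => [/allP v0|i _]; last first.
  by rewrite -!expr2 addr_ge0 ?sqr_ge0.
apply/matrixP => i j; rewrite ord1 mxE; apply/eqP; rewrite eq_complex.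
have /= := v0 i (mem_index_enum _).
by rewrite -!expr2 paddr_eq0 ?sqr_ge0// !sqrf_eq0.
Qed.

Lemma enormE n (v : 'cV[C]_n) : enorm v = Num.sqrt (rdot v v).
Proof. by []. Qed.

Lemma enorm_ge0 n (v : 'cV[C]_n) : 0 <= enorm v.
Proof. exact: sqrtr_ge0. Qed.

Lemma sqr_enorm n (v : 'cV[C]_n) : enorm v ^+ 2 = rdot v v.
Proof. by rewrite sqr_sqrtr// rdot_ge0. Qed.

Lemma enorm_eq0 n (v : 'cV[C]_n) : (enorm v == 0) = (v == 0).
Proof. by rewrite -sqrf_eq0 sqr_enorm rdot_eq0. Qed.

Lemma enorm0 n : enorm (0 : 'cV[C]_n) = 0.
Proof. by apply/eqP; rewrite enorm_eq0. Qed.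

Lemma enorm_gt0 n (v : 'cV[C]_n) : (0 < enorm v) = (v != 0).
Proof. by rewrite lt_neqAle enorm_ge0 andbT eq_sym enorm_eq0. Qed.

Lemma enormZ n (v : 'cV[C]_n) a : enorm (a%:C *: v) = `|a| * enorm v.
Proof. by rewrite enormE rdotZl rdotZr mulrA -expr2 sqrtrM ?sqr_ge0// sqrtr_sqr. Qed.

(** Cauchy-Schwarz, from the nonnegative squared norm of [|v| u - |u| v], which factors as
    [2 |u| |v| (|u| |v| - rdot u v)]. *)
Lemma rdot_le n (u v : 'cV[C]_n) : rdot u v <= enorm u * enorm v.
Proof.
have [->|u0] := eqVneq u 0.
  by rewrite rdotC /rdot mulmx0 mxE mulr_ge0// enorm_ge0.
have [->|v0] := eqVneq v 0.
  by rewrite /rdot mulmx0 mxE mulr_ge0// enorm_ge0.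
rewrite -enorm_gt0 in u0; rewrite -enorm_gt0 in v0.
have := rdot_ge0 ((enorm v)%:C *: u - (enorm u)%:C *: v).
rewrite !(rdotDl, rdotDr, rdotNl, rdotNr, rdotZl, rdotZr) -!sqr_enorm (rdotC v u).
rewrite [X in 0 <= X](_ : _ =
   2 * (enorm u * enorm v) * (enorm u * enorm v - rdot u v)); last by ring.
by rewrite pmulr_rge0 ?subr_ge0// !mulr_gt0.
Qed.

Lemma coord_le_enorm n (v : 'cV[C]_n) i :
  `|Re (v i 0)| <= enorm v /\ `|Im (v i 0)| <= enorm v.
Proof.
have h : Re (v i 0) ^+ 2 + Im (v i 0) ^+ 2 <= enorm v ^+ 2.
  rewrite sqr_enorm rdotE (bigD1 i)//= !expr2 lerDl.
  by apply: sumr_ge0 => j _; rewrite -!expr2 addr_ge0 ?sqr_ge0.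
by split; rewrite -ler_sqr ?nnegrE ?enorm_ge0// real_normK ?num_real//;
  apply: le_trans h; rewrite ?lerDl ?lerDr sqr_ge0.
Qed.

End RealInnerProduct.

(** * Hermitian matrices and the spectral norm *)

Section Hermitian.
Variable R : realType.
Local Notation C := R[i].

Lemma hermitian_diag n (H : 'M[C]_n) : H^t* = H ->
  exists (P : 'M[C]_n) (d : 'I_n -> R), P \is unitarymx /\
    H = P^t* *m diag_mx (\row_i (d i)%:C) *m P.
Proof.
move=> hH.
have Hh : H \is hermsymmx.
  by apply/is_hermitianmxP; rewrite expr0 scale1r hH.
have Hn := hermitian_normalmx Hh.
exists (spectralmx H), (fun i => Re (spectral_diag H 0 i)).
split; first exact: spectral_unitarymx.
have -> : \row_i (Re (spectral_diag H 0 i))%:C = spectral_diag H.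
  apply/rowP => i; rewrite mxE RRe_real//.
  exact: (mxOverP (hermitian_spectral_diag_real Hh)).
by have := orthomx_spectralP Hn; rewrite invmx_unitary ?spectral_unitarymx.
Qed.

(** Eigenvectors are row vectors here, so the rows of [P] serve as eigenvectors. *)
Lemma eigenvalue_diag n (P : 'M[C]_n) (d : 'rV[C]_n) i : P \is unitarymx ->
  eigenvalue (P^t* *m diag_mx d *m P) (d 0 i).
Proof.
move=> uP; apply/eigenvalueP; exists (row i P).
  rewrite rowE -!mulmxA [P *m (P^t* *m _)]mulmxA (unitarymxP uP) mul1mx.
  by rewrite mulmxA -(rowE i (diag_mx d)) row_diag_mx -scalemxAl -rowE.
rewrite rowE; apply/eqP => /(congr1 (mulmx^~ (P^t*))).
rewrite -mulmxA (unitarymxP uP) mulmx1 mul0mx => /matrixP/(_ 0 i)/eqP.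
by rewrite !mxE !eqxx oner_eq0.
Qed.

Lemma rdot_diag n (d : 'I_n -> R) (w : 'cV[C]_n) :
  rdot w (diag_mx (\row_i (d i)%:C) *m w) =
  \sum_i d i * (Re (w i 0) * Re (w i 0) + Im (w i 0) * Im (w i 0)).
Proof.
rewrite rdotE; apply: eq_bigr => i _.
rewrite mul_diag_mx !mxE ReM ImM /= !mul0r subr0 addr0; ring.
Qed.

Lemma rdot_unitary n (P : 'M[C]_n) v : P \is unitarymx ->
  rdot (P *m v) (P *m v) = rdot v v.
Proof.
move=> uP; rewrite rdot_adjl mulmxA -(invmx_unitary uP).
by rewrite mulVmx ?unitarymx_unit// mul1mx.
Qed.

(** The adjoint of a left (row) eigenvector is a right eigenvector because [H] is Hermitian and [x]
    is real. *)
Lemma eigenvalue_quadratic n (H : 'M[C]_n) (x : R) : H^t* = H ->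
  eigenvalue H x%:C ->
  exists2 v : 'cV[C]_n, v != 0 & rdot v (H *m v) = x * rdot v v.
Proof.
move=> hH /eigenvalueP [w wH w0]; exists (w^t*).
  apply: contra_neq w0 => /(congr1 (fun X : 'cV_n => X^t*)).
  by rewrite trmxCK trmx0 map_mx0.
rewrite rdot_adjr hH -{1}hH -map_mxM -trmx_mul wH linearZ /= map_mxZ /=.
rewrite (conjc_real x : Num.conj x%:C = x%:C); exact: rdotZl.
Qed.

Lemma lambda_min_bounds n (H : 'M[C]_n) : (0 < n)%N -> H^t* = H ->
  (forall v, v != 0 -> 0 < rdot v (H *m v)) ->
  0 < lambda_min H /\ forall v, lambda_min H * rdot v v <= rdot v (H *m v).
Proof.
move=> n0 hH Hpos; have [P [d [uP HE]]] := hermitian_diag hH.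
have quad v : rdot v (H *m v) = rdot (P *m v) (diag_mx (\row_i (d i)%:C) *m (P *m v)).
  by rewrite rdot_adjl HE !mulmxA.
have eigd i : eigenvalue H (d i)%:C.
  by have := eigenvalue_diag (\row_i (d i)%:C) i uP; rewrite mxE -HE.
have lower c : (forall i, c <= d i) -> forall v, c * rdot v v <= rdot v (H *m v).
  move=> cd v; rewrite quad -(rdot_unitary v uP) rdot_diag rdotE mulr_sumr.
  by apply: ler_sum => i _; rewrite ler_wpM2r// -!expr2 addr_ge0// sqr_ge0.
have eigpos x : eigenvalue H x%:C -> 0 < x.
  move=> /(eigenvalue_quadratic hH)[v v0 hv].
  have := Hpos v v0; rewrite hv pmulr_lgt0// lt_neqAle rdot_ge0.
  by rewrite eq_sym rdot_eq0 v0.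
have lbE : lbound [set x : R | eigenvalue H x%:C] 0.
  by move=> x /= /eigpos /ltW.
pose i0 : 'I_n := Ordinal n0.
(* Positive eigenvalues alone would only give an infimum [>= 0]. The least diagonal entry [c] is
   itself an eigenvalue, hence positive, and by the Rayleigh quotient it is a lower bound of all
   eigenvalues. *)
pose c := d [arg min_(i < i0) d i]%O.
have cmin i : c <= d i.
  by rewrite /c; case: arg_minP => //= j _; apply.
split; last first.
  by apply: lower => i; apply: ge_inf; [exists 0|exact: eigd].
apply: (@lt_le_trans _ _ c); first exact/eigpos/eigd.
apply: lb_le_inf; first by exists (d i0); exact: eigd.
move=> x /= /(eigenvalue_quadratic hH)[v v0 hv].
have := lower c cmin v; rewrite hv ler_pM2r//.
by rewrite lt_neqAle rdot_ge0 eq_sym rdot_eq0 v0.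
Qed.

(** Applied to [A^H A], this bounds the set whose supremum is [specnorm A]. Any finite bound will
    do, so the sum of the absolute eigenvalues is taken. *)
Lemma quadratic_ub n (H : 'M[C]_n) : H^t* = H ->
  exists2 K : R, 0 <= K & forall v, rdot v (H *m v) <= K * rdot v v.
Proof.
move=> hH; have [P [d [uP HE]]] := hermitian_diag hH.
have dle i : d i <= \sum_j `|d j|.
  by rewrite (bigD1 i)//= (le_trans (ler_norm _))// lerDl sumr_ge0.
exists (\sum_j `|d j|); first exact: sumr_ge0.
move=> v; rewrite HE -!mulmxA rdot_adjr trmxCK -(rdot_unitary v uP).
rewrite rdot_diag rdotE mulr_sumr; apply: ler_sum => i _.
by rewrite ler_wpM2r// -!expr2 addr_ge0// sqr_ge0.
Qed.

Lemma specnorm_sup m n (A : 'M[C]_(m, n)) :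
  has_sup [set enorm (A *m v) | v in [set v : 'cV[C]_n | enorm v <= 1]].
Proof.
split; first by exists 0, 0 => //=; rewrite ?mulmx0 enorm0.
have [|K K0 hK] := @quadratic_ub n (A^t* *m A).
  by rewrite trmx_mul map_mxM trmxCK.
exists (Num.sqrt K) => _ [v /= v1 <-]; rewrite ler_wsqrtr// -/(rdot _ _).
rewrite rdot_adjl mulmxA (le_trans (hK v))// -sqr_enorm ler_piMr//.
by rewrite expr_le1// enorm_ge0.
Qed.

Lemma enorm_mulmx m n (A : 'M[C]_(m, n)) v :
  enorm (A *m v) <= specnorm A * enorm v.
Proof.
have [->|v0] := eqVneq v 0.
  by rewrite mulmx0 !enorm0 mulr0.
rewrite -enorm_gt0 in v0.
rewrite -ler_pdivrMr// mulrC -[X in X * _]ger0_norm ?invr_ge0 ?enorm_ge0//.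
rewrite -enormZ scalemxAr; apply: ub_le_sup; first by case: (specnorm_sup A).
exists ((enorm v)^-1%:C *: v) => //=.
by rewrite enormZ ger0_norm ?invr_ge0 ?enorm_ge0// mulVf ?gt_eqF.
Qed.

Lemma specnorm_ge0 m n (A : 'M[C]_(m, n)) : 0 <= specnorm A.
Proof.
apply: ub_le_sup; first by case: (specnorm_sup A).
by exists 0; rewrite /= ?mulmx0 enorm0.
Qed.

Lemma specnorm_le m n (A : 'M[C]_(m, n)) K : 0 <= K ->
  (forall v, enorm (A *m v) <= K * enorm v) -> specnorm A <= K.
Proof.
move=> K0 h; apply: ge_sup; first by case: (specnorm_sup A).
by move=> _ [v /= v1 <-]; rewrite (le_trans (h v))// ler_piMr.
Qed.

End Hermitian.

(** * Least squares and Krylov spaces *)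

Section LeastSquares.
Variable R : realType.
Local Notation C := R[i].

Lemma unitmx_colker n (M : 'M[C]_n) :
  (forall v : 'cV_n, M *m v = 0 -> v = 0) -> M \in unitmx.
Proof.
move=> inj; rewrite -unitmx_tr -row_free_unit -kermx_eq0; apply/rowV0P => u.
move=> /sub_kermxP uM; apply: trmx_inj; rewrite trmx0; apply: inj.
by apply: trmx_inj; rewrite trmx_mul trmxK trmx0.
Qed.

Lemma enorm_orthogonal n (u w : 'cV[C]_n) : rdot u w = 0 ->
  enorm u <= enorm (u + w).
Proof.
move=> uw; rewrite ler_wsqrtr// -/(rdot _ _) -/(rdot _ _).
by rewrite !(rdotDl, rdotDr) (rdotC w) uw addr0 add0r lerDl rdot_ge0.
Qed.

Variables (m n : nat) (M : 'M[C]_(m, n)).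
Hypothesis M_inj : forall y : 'cV_n, M *m y = 0 -> y = 0.

Lemma gram_unit : M^t* *m M \in unitmx.
Proof.
apply: unitmx_colker => v Gv; apply: M_inj; apply/eqP.
by rewrite -rdot_eq0 rdot_adjl mulmxA Gv /rdot mulmx0 mxE.
Qed.

(** An explicit solution of the Penrose equations, so that the choice made by [mpinv] does satisfy
    them. *)
Let pinv := invmx (M^t* *m M) *m M^t*.

Let pinvK : pinv *m M = 1%:M.
Proof. by rewrite -mulmxA mulVmx ?gram_unit. Qed.

Let pinv_penrose : moore_penrose M pinv.
Proof.
have GH : (M^t* *m M)^t* = M^t* *m M by rewrite trmx_mul map_mxM trmxCK.
split.
- by rewrite -mulmxA pinvK mulmx1.
- by rewrite pinvK mul1mx.
- by rewrite !trmx_mul !map_mxM trmxCK trmx_inv map_invmx GH mulmxA.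
- by rewrite pinvK trmx1 map_mx1.
Qed.

Let mpinv_penrose : moore_penrose M (mpinv M).
Proof. by apply: (@xgetPex _ 0 [set X | moore_penrose M X]); exists pinv. Qed.

(** The normal equations: with [X = mpinv M], [M^H M X = M^H (M X)^H = (M X M)^H = M^H]. The closed
    form of [mpinv M] and its least-squares property both come from here. *)
Let gram_mpinv : M^t* *m M *m mpinv M = M^t*.
Proof.
have [MXM _ MXH _] := mpinv_penrose.
by rewrite -mulmxA -MXH -map_mxM -trmx_mul MXM.
Qed.

Lemma mpinvE : mpinv M = invmx (M^t* *m M) *m M^t*.
Proof. by rewrite -[X in _ *m X]gram_mpinv mulKmx ?gram_unit. Qed.

Lemma mpinvK : mpinv M *m M = 1%:M.
Proof. by rewrite mpinvE pinvK. Qed.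

(** By the normal equations the residual is orthogonal to the range of [M], so moving to another [y]
    adds an orthogonal term. *)
Lemma enorm_mpinv_residual c y :
  enorm (c - M *m (mpinv M *m c)) <= enorm (c - M *m y).
Proof.
have -> : c - M *m y = c - M *m (mpinv M *m c) + M *m (mpinv M *m c - y).
  by rewrite mulmxBr addrA subrK.
apply: enorm_orthogonal.
by rewrite rdot_adjr mulmxBr !mulmxA gram_mpinv subrr rdotC /rdot mulmx0 mxE.
Qed.

(** [M *m mpinv M] is an orthogonal projection; this later bounds [mpinv (M t)] itself. *)
Lemma enorm_mpinv_proj c : enorm (M *m (mpinv M *m c)) <= enorm c.
Proof.
rewrite -[X in _ <= enorm X](subrKC (M *m (mpinv M *m c)) c).
apply: enorm_orthogonal.
by rewrite rdotC rdot_adjr mulmxBr !mulmxA gram_mpinv subrr rdotC /rdot mulmx0 mxE.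
Qed.

End LeastSquares.

Section Krylov.
Variable R : realType.
Local Notation C := R[i].
Variables (n : nat) (A : 'M[C]_n) (b : 'cV[C]_n).

Lemma krylovS m : (krylov A b m <= krylov A b m.+1)%VS.
Proof.
apply/span_subvP => _ /mapP[k + ->].
rewrite mem_iota /= add0n => km; apply: memv_span; apply/mapP; exists k => //.
by rewrite mem_iota /= add0n ltnS ltnW.
Qed.

Lemma krylov_start m : b \in krylov A b m.+1.
Proof.
by apply: memv_span; apply/mapP; exists 0%N; rewrite // expr0 mul1mx.
Qed.

Lemma krylov_mul m v : v \in krylov A b m -> A *m v \in krylov A b m.+1.
Proof.
move=> vK; have -> : A *m v = linfun (mulmx A) v by rewrite lfunE.
apply: (subvP _ _ (memv_img _ vK)); rewrite limg_span.
apply/span_subvP => _ /mapP[_ /mapP[k + ->] ->].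
rewrite mem_iota /= add0n => km; apply: memv_span; apply/mapP; exists k.+1.
  by rewrite mem_iota.
by rewrite lfunE /= mulmxA exprS.
Qed.

Variables (m : nat) (V : 'M[C]_(n, m)).
Hypothesis V_basis : basis_of (krylov A b m) [seq col j V | j : 'I_m].

(** The columns as a tuple, the form in which coordinates and freeness are available. *)
Let colsV := [tuple col j V | j < m].

Let mulmx_colsV (y : 'cV_m) : V *m y = \sum_i y i 0 *: colsV`_i.
Proof.
apply/colP => i; rewrite mxE summxE; apply: eq_bigr => j _.
by rewrite nth_mktuple !mxE mulrC.
Qed.

Lemma krylov_basis_mem (y : 'cV_m) : V *m y \in krylov A b m.
Proof.
rewrite mulmx_colsV -(span_basis V_basis); apply: memv_suml => i _.
by apply/memvZ/memv_span; rewrite nth_mktuple fintype.image_f.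
Qed.

Lemma krylov_basis_surj z : z \in krylov A b m -> exists y : 'cV_m, z = V *m y.
Proof.
rewrite -(span_basis V_basis) => zV; exists (\col_i coord colsV i z).
rewrite mulmx_colsV [LHS](@coord_span _ _ _ colsV)//.
by apply: eq_bigr => i _; rewrite mxE.
Qed.

Lemma krylov_basis_inj (y : 'cV_m) : V *m y = 0 -> y = 0.
Proof.
rewrite mulmx_colsV => Vy; apply/colP => i; rewrite mxE.
by have /freeP/(_ _ Vy) := basis_free V_basis : free colsV.
Qed.

End Krylov.

(** * Shifted positive real systems *)

Section PositiveReal.
Variable R : realType.
Local Notation C := R[i].
Implicit Types n : nat.

Lemma positive_real_gt0 n (A : 'M[C]_n) : positive_real A ->
  forall v, v != 0 -> 0 < rdot v (A *m v).
Proof. by move=> hA v /hA; rewrite /rdot mulmxA. Qed.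

Lemma positive_real_unit n (A : 'M[C]_n) : positive_real A -> A \in unitmx.
Proof.
move=> hA; apply: unitmx_colker => v Av; apply: contraTeq isT => v0.
by have := positive_real_gt0 hA v0; rewrite Av /rdot mulmx0 mxE ltxx.
Qed.

(** Substitute [v = A w]: the form of [invmx A] at [v] is that of [A] at [w], by symmetry of
    [rdot]. *)
Lemma positive_real_invmx n (A : 'M[C]_n) :
  positive_real A -> positive_real (invmx A).
Proof.
move=> hA v v0; have uA := positive_real_unit hA.
rewrite -mulmxA -/(rdot _ _) -{1}(mulKVmx uA v) rdotC.
apply: positive_real_gt0 => //; apply: contra_neq v0 => v0.
by rewrite -(mulKVmx uA v) v0 mulmx0.
Qed.

Lemma herm_part_adj n (A : 'M[C]_n) : (herm_part A)^t* = herm_part A.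
Proof.
rewrite /herm_part linearZ /= map_mxZ linearD /= map_mxD trmxCK addrC.
by congr (_ *: _); rewrite fmorphV rmorph_nat.
Qed.

Lemma rdot_herm_part n (A : 'M[C]_n) v : rdot v (herm_part A *m v) = rdot v (A *m v).
Proof.
have -> : herm_part A = (2^-1 : R)%:C *: (A + A^t*).
  by rewrite /herm_part fmorphV rmorph_nat.
rewrite -scalemxAl rdotZr mulmxDl rdotDr (rdot_adjr (A^t*)) trmxCK.
rewrite (rdotC (A *m v)); lra.
Qed.

Lemma lambda_min_herm_part n (A : 'M[C]_n) : (0 < n)%N -> positive_real A ->
  0 < lambda_min (herm_part A) /\
  forall v, lambda_min (herm_part A) * rdot v v <= rdot v (A *m v).
Proof.
move=> n0 hA; have [|l0 hl] := lambda_min_bounds n0 (herm_part_adj A).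
  by move=> v v0; rewrite rdot_herm_part positive_real_gt0.
by split => // v; rewrite -(rdot_herm_part A v).
Qed.

Lemma mulmx_shift n (A : 'M[C]_n) t (v : 'cV_n) :
  (t%:C%:M + A) *m v = t%:C *: v + A *m v.
Proof. by rewrite mulmxDl mul_scalar_mx. Qed.

Variables (n : nat) (A : 'M[C]_n).
Hypotheses (n_gt0 : (0 < n)%N) (hA : positive_real A).

Local Notation delta := (lambda_min (herm_part A)).
Local Notation rho := (lambda_min (herm_part (invmx A))).
Local Notation a := (specnorm A).

Lemma fov_gt0 : 0 < delta.
Proof. by case: (lambda_min_herm_part n_gt0 hA). Qed.

Lemma fov_inv_gt0 : 0 < rho.
Proof. by case: (lambda_min_herm_part n_gt0 (positive_real_invmx hA)). Qed.

Lemma fov_le v : delta * rdot v v <= rdot v (A *m v).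
Proof. by case: (lambda_min_herm_part n_gt0 hA). Qed.

Lemma fov_inv_le v : rho * rdot (A *m v) (A *m v) <= rdot v (A *m v).
Proof.
have [_] := lambda_min_herm_part n_gt0 (positive_real_invmx hA).
by move=> /(_ (A *m v)); rewrite mulKmx ?positive_real_unit// (rdotC (A *m v) v).
Qed.

Lemma shift_lower t v : (t + delta) * enorm v <= enorm ((t%:C%:M + A) *m v).
Proof.
have [->|v0] := eqVneq v 0; first by rewrite enorm0 mulr0 enorm_ge0.
rewrite -enorm_gt0 in v0; rewrite -(ler_pM2l v0).
apply: le_trans (rdot_le _ _).
rewrite mulmx_shift rdotDr rdotZr.
have := fov_le v; rewrite -!sqr_enorm; lra.
Qed.

Lemma fov_le_specnorm : delta <= a.
Proof.
pose v : 'cV[C]_n := const_mx 1.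
have v0 : 0 < enorm v.
  rewrite enorm_gt0; apply/eqP => /colP/(_ (Ordinal n_gt0))/eqP.
  by rewrite !mxE oner_eq0.
rewrite -(ler_pM2r v0); apply: le_trans (enorm_mulmx A v).
by have := shift_lower 0 v; rewrite add0r mulmx_shift scale0r add0r.
Qed.

Lemma specnorm_gt0 : 0 < a.
Proof. exact: lt_le_trans fov_gt0 fov_le_specnorm. Qed.

(** From [rho |A v|^2 <= rdot v (A v) <= |v| |A v|] follows [|A v| <= |v| / rho], hence
    [|A| <= 1 / rho]. *)
Lemma fov_inv_specnorm : rho * a <= 1.
Proof.
rewrite mulrC -ler_pdivlMr ?fov_inv_gt0// mul1r.
apply: specnorm_le; first by rewrite invr_ge0 ltW ?fov_inv_gt0.
move=> v; have [->|Av0] := eqVneq (A *m v) 0.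
  by rewrite enorm0 mulr_ge0 ?enorm_ge0// invr_ge0 ltW ?fov_inv_gt0.
rewrite -enorm_gt0 in Av0; rewrite mulrC ler_pdivlMr ?fov_inv_gt0//.
rewrite -(ler_pM2r Av0) mulrAC -expr2 mulrC sqr_enorm.
exact: le_trans (fov_inv_le v) (rdot_le _ _).
Qed.

Lemma shift_unit t : 0 <= t -> t%:C%:M + A \in unitmx.
Proof.
move=> t0; apply: unitmx_colker => v tv; apply/eqP; rewrite -enorm_eq0.
have := shift_lower t v; rewrite tv enorm0 pmulr_rle0 ?ltr_wpDl ?fov_gt0//.
by rewrite le_eqVlt ltNge enorm_ge0 orbF.
Qed.

(* Expanding [|(t + A) w|^2], the cross term is bounded below through [rho], and
   [rho * |A| <= 1] completes the square. *)
Lemma shift_resolvent_bound t w : 0 <= t ->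
  enorm (A *m w) * (t + rho * a ^+ 2) <= a * enorm ((t%:C%:M + A) *m w).
Proof.
move=> t0; have a0 := ltW specnorm_gt0; have r0 := ltW fov_inv_gt0.
rewrite -ler_sqr ?nnegrE ?mulr_ge0 ?addr_ge0 ?enorm_ge0 ?mulr_ge0 ?sqr_ge0//.
rewrite !exprMn !sqr_enorm mulmx_shift !(rdotDl, rdotDr, rdotZl, rdotZr).
rewrite (rdotC (A *m w) w).
have h1 := fov_inv_le w.
have h2 : rdot (A *m w) (A *m w) <= a ^+ 2 * rdot w w.
  by rewrite -!sqr_enorm -exprMn lerXn2r ?nnegrE ?mulr_ge0 ?enorm_ge0// enorm_mulmx.
have h3 : (rho * a) ^+ 2 <= 1 by rewrite expr_le1 ?mulr_ge0 ?fov_inv_specnorm.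
have h4 := rdot_ge0 (A *m w).
move: h1 h2 h4; set x := rdot (A *m w) _; set y := rdot w (A *m w).
set z := rdot w w => h1 h2 h4.
have e1 : t ^+ 2 * x <= t ^+ 2 * (a ^+ 2 * z) by rewrite ler_wpM2l ?sqr_ge0.
have e2 : 2 * t * a ^+ 2 * (rho * x) <= 2 * t * a ^+ 2 * y.
  by rewrite ler_wpM2l ?mulr_ge0 ?sqr_ge0.
have e3 : (rho * a) ^+ 2 * (a ^+ 2 * x) <= 1 * (a ^+ 2 * x).
  by rewrite ler_wpM2r ?mulr_ge0 ?sqr_ge0.
move: e1 e2 e3; clear; move: (specnorm A) (lambda_min _) x y z => a' r' x y z; lra.
Qed.

Local Notation sin0 := (Num.sqrt (1 - (delta / a) ^+ 2)).

Lemma fov_ratio : 0 < delta / a <= 1.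
Proof.
by rewrite divr_gt0 ?fov_gt0 ?specnorm_gt0//= ler_pdivrMr ?specnorm_gt0 ?mul1r ?fov_le_specnorm.
Qed.

(** With damping [alpha], the squared norm on the left is at most [1 - 2 alpha (t + delta) + alpha^2
    (t + a)^2] times [|r|^2]. The chosen [alpha] minimizes this quadratic, with value
    [1 - ((t + delta) / (t + a))^2]. *)
Lemma shift_richardson t r : 0 <= t ->
  enorm (r - ((t + delta) / (t + a) ^+ 2)%:C *: ((t%:C%:M + A) *m r))
  <= sin0 * enorm r.
Proof.
move=> t0; set alpha := (t + delta) / (t + a) ^+ 2.
have d0 := ltW fov_gt0; have a0 := ltW specnorm_gt0; have da := fov_le_specnorm.
have alpha0 : 0 <= alpha by rewrite divr_ge0 ?sqr_ge0 ?addr_ge0.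
have ta0 : 0 < t + a by rewrite ltr_wpDl// specnorm_gt0.
have ta1 := ltW ta0.
have /andP[/ltW q0 q1] := fov_ratio.
have s0 : 0 <= 1 - (delta / a) ^+ 2 by rewrite subr_ge0 expr_le1.
rewrite -ler_sqr ?nnegrE ?mulr_ge0 ?enorm_ge0 ?sqrtr_ge0// exprMn !sqr_enorm sqr_sqrtr//.
have h1 : (t + delta) * rdot r r <= rdot r ((t%:C%:M + A) *m r).
  by rewrite mulmx_shift rdotDr rdotZr mulrDl lerD2l fov_le.
have h2 : enorm ((t%:C%:M + A) *m r) ^+ 2 <= (t + a) ^+ 2 * rdot r r.
  rewrite -[rdot r r]sqr_enorm -exprMn lerXn2r ?nnegrE ?mulr_ge0 ?enorm_ge0//.
  rewrite -ler_sqr ?nnegrE ?mulr_ge0 ?enorm_ge0// exprMn !sqr_enorm.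
  rewrite mulmx_shift !(rdotDl, rdotDr, rdotZl, rdotZr) (rdotC (A *m r)).
  have g1 := enorm_mulmx A r.
  have g2 := rdot_le r (A *m r).
  have g3 : rdot (A *m r) (A *m r) <= a ^+ 2 * rdot r r.
    by rewrite -!sqr_enorm -exprMn lerXn2r ?nnegrE ?mulr_ge0 ?enorm_ge0.
  have g4 : rdot r (A *m r) <= a * rdot r r.
    rewrite (le_trans g2)// -sqr_enorm expr2 mulrCA ler_wpM2l ?enorm_ge0//.
  have g5 : 2 * t * rdot r (A *m r) <= 2 * t * (a * rdot r r).
    by rewrite ler_wpM2l ?mulr_ge0.
  move: g3 g5; clear; move: (rdot _ _) (rdot _ _) (rdot _ _) (specnorm A).
  by move=> x y z a'; lra.
(* Because [delta <= a], the ratio grows with [t]: the unshifted system is the worst case, which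
   makes the contraction factor independent of [t]. *)
have h3 : delta / a <= (t + delta) / (t + a).
  rewrite ler_pdivrMr ?specnorm_gt0// mulrAC ler_pdivlMr// mulrDr mulrDl lerD2r.
  by rewrite mulrC ler_wpM2l.
have h4 : (delta / a) ^+ 2 <= ((t + delta) / (t + a)) ^+ 2.
  by rewrite lerXn2r ?nnegrE// (le_trans q0).
have h5 : alpha * (t + delta) = ((t + delta) / (t + a)) ^+ 2.
  by rewrite /alpha expr_div_n mulrAC -expr2.
have h6 : alpha ^+ 2 * (t + a) ^+ 2 = ((t + delta) / (t + a)) ^+ 2.
  by rewrite /alpha; field; rewrite gt_eqF.
have h7 : alpha * ((t + delta) * rdot r r) <= alpha * rdot r ((t%:C%:M + A) *m r).
  by rewrite ler_wpM2l.
have h8 : alpha ^+ 2 * enorm ((t%:C%:M + A) *m r) ^+ 2 <= alpha ^+ 2 * ((t + a) ^+ 2 * rdot r r).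
  by rewrite ler_wpM2l ?sqr_ge0.
have h9 : (delta / a) ^+ 2 * rdot r r <= ((t + delta) / (t + a)) ^+ 2 * rdot r r.
  by rewrite ler_wpM2r ?rdot_ge0.
move: h7 h8; rewrite [X in X <= _]mulrA h5 => h7.
rewrite [X in _ <= X]mulrA h6 sqr_enorm => h8.
rewrite !(rdotDl, rdotDr, rdotNl, rdotNr, rdotZl, rdotZr).
rewrite (rdotC ((t%:C%:M + A) *m r) r).
move: h7 h8 h9; set x := rdot r r; set y := rdot r (_ *m r); set z := rdot (_ *m r) _.
set q := ((_ + _) / _) ^+ 2; set p := (delta / a) ^+ 2.
clearbody x y z q p alpha; clear; lra.
Qed.

(** Adding [alpha] times the residual [r] to [z] changes the residual to [r - alpha (t + A) r], and
    since [r] lies in the next Krylov space each step raises the dimension index by one. *)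
Lemma shift_gmres_bound (b : 'cV[C]_n) m t : 0 <= t ->
  exists2 z, z \in krylov A b m &
    enorm (b - (t%:C%:M + A) *m z) <= sin0 ^+ m * enorm b.
Proof.
move=> t0; set alpha := (t + delta) / (t + a) ^+ 2.
elim: m => [|m [z zK hz]].
  by exists 0; rewrite ?mem0v// mulmx0 subr0 expr0 mul1r.
exists (z + alpha%:C *: (b - (t%:C%:M + A) *m z)).
  have zK1 : z \in krylov A b m.+1 by apply: subvP zK; exact: krylovS.
  rewrite memvD// memvZ// memvB ?krylov_start// mulmx_shift memvD ?memvZ//.
  exact: krylov_mul.
rewrite mulmxDr -scalemxAr opprD addrA.
apply: le_trans (shift_richardson _ t0) _.
by rewrite (exprS _ m) -mulrA ler_wpM2l ?sqrtr_ge0.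
Qed.

End PositiveReal.

(** * Sketched residual and error for a single shift *)

Section SketchedGmres.
Variable R : realType.
Local Notation C := R[i].
Variables (n m s : nat) (A : 'M[C]_n) (b : 'cV[C]_n) (eps : R).
Variables (S : 'M[C]_(s, n)) (V : 'M[C]_(n, m)).
Hypotheses (n_gt0 : (0 < n)%N) (hA : positive_real A) (heps : 0 <= eps < 1).
Hypothesis hS : forall v : 'cV[C]_n, v \in krylov A b m.+1 ->
  (1 - eps) * enorm v ^+ 2 <= enorm (S *m v) ^+ 2 <= (1 + eps) * enorm v ^+ 2.
Hypothesis hV : basis_of (krylov A b m) [seq col j V | j : 'I_m].

Local Notation delta := (lambda_min (herm_part A)).
Local Notation rho := (lambda_min (herm_part (invmx A))).
Local Notation a := (specnorm A).
Local Notation sin0 := (Num.sqrt (1 - (delta / a) ^+ 2)).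
Local Notation Ceps := (Num.sqrt ((1 + eps) / (1 - eps))).
Local Notation M t := (t%:C *: (S *m V) + S *m A *m V).

Lemma sketch_lower v : v \in krylov A b m.+1 ->
  Num.sqrt (1 - eps) * enorm v <= enorm (S *m v).
Proof.
move=> /hS/andP[h _]; have /andP[e0 e1] := heps.
rewrite -ler_sqr ?nnegrE ?mulr_ge0 ?sqrtr_ge0 ?enorm_ge0//.
by rewrite exprMn sqr_sqrtr// subr_ge0 ltW.
Qed.

Lemma sketch_upper v : v \in krylov A b m.+1 ->
  enorm (S *m v) <= Num.sqrt (1 + eps) * enorm v.
Proof.
move=> /hS/andP[_ h]; have /andP[e0 e1] := heps.
rewrite -ler_sqr ?nnegrE ?mulr_ge0 ?sqrtr_ge0 ?enorm_ge0//.
by rewrite exprMn [Num.sqrt _ ^+ 2 in leRHS]sqr_sqrtr// addr_ge0.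
Qed.

Let sqrt_eps_gt0 : 0 < Num.sqrt (1 - eps).
Proof. by rewrite sqrtr_gt0 subr_gt0; case/andP: heps. Qed.

Lemma sketch_mulmx t (y : 'cV_m) : M t *m y = S *m ((t%:C%:M + A) *m (V *m y)).
Proof. by rewrite mulmx_shift mulmxDr mulmxDl -scalemxAl -scalemxAr !mulmxA. Qed.

Lemma shift_krylov t (v : 'cV_n) : v \in krylov A b m ->
  (t%:C%:M + A) *m v \in krylov A b m.+1.
Proof.
move=> vK; rewrite mulmx_shift memvD ?krylov_mul// memvZ//.
by apply: subvP vK; exact: krylovS.
Qed.

Lemma sketch_mulmx_lower t (y : 'cV_m) : 0 <= t ->
  Num.sqrt (1 - eps) * (t + delta) * enorm (V *m y) <= enorm (M t *m y).
Proof.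
move=> t0; rewrite sketch_mulmx -mulrA.
apply: le_trans (sketch_lower (shift_krylov _ (krylov_basis_mem hV y))).
by rewrite ler_pM2l// shift_lower.
Qed.

(** Full column rank: [t + A] stretches by at least [t + delta], [S] kills no nonzero vector of
    [K_{m+1}] as [eps < 1], and the columns of [V] are independent. *)
Lemma sketch_inj t (y : 'cV_m) : 0 <= t -> M t *m y = 0 -> y = 0.
Proof.
move=> t0 My; apply: (krylov_basis_inj hV); apply/eqP; rewrite -enorm_eq0.
have := sketch_mulmx_lower y t0; rewrite My enorm0 pmulr_rle0; last first.
  by rewrite mulr_gt0// ltr_wpDl// fov_gt0.
by rewrite le_eqVlt ltNge enorm_ge0 orbF.
Qed.

(** Both the sketched and the Richardson residual lie in [K_{m+1}]: the lower embedding bound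
    applies to the first, least squares compares their sketches, and the upper bound applies to the
    second. *)
Lemma sketched_residual t : 0 <= t ->
  enorm (b - (t%:C%:M + A) *m (V *m (mpinv (M t) *m (S *m b))))
  <= Ceps * (enorm b * sin0 ^+ m).
Proof.
move=> t0; have [z zK hz] := shift_gmres_bound n_gt0 hA b m t0.
have [y zE] := krylov_basis_surj hV zK; rewrite {}zE in zK hz.
have resK x : b - (t%:C%:M + A) *m (V *m x) \in krylov A b m.+1.
  by rewrite memvB ?krylov_start ?shift_krylov ?krylov_basis_mem.
have hr := sketch_lower (resK (mpinv (M t) *m (S *m b))).
rewrite mulmxBr -sketch_mulmx in hr.
have hm := enorm_mpinv_residual (fun y => @sketch_inj t y t0) (S *m b) y.
have := sketch_upper (resK y); rewrite mulmxBr -sketch_mulmx => hu.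
have /andP[e0 e1] := heps.
have e2 : 0 <= 1 - eps by rewrite subr_ge0 ltW.
rewrite sqrtrM ?addr_ge0// sqrtrV//.
rewrite [leRHS]mulrAC ler_pdivlMr// mulrC (le_trans hr)// (le_trans hm)// (le_trans hu)//.
by rewrite ler_wpM2l ?sqrtr_ge0// mulrC.
Qed.

(** [t + A] maps the error to the residual, so [shift_resolvent_bound] converts the residual
    bound. *)
Lemma sketched_error t : 0 <= t ->
  enorm (A *m (invmx (t%:C%:M + A) *m b - V *m (mpinv (M t) *m (S *m b))))
  <= a * (t + rho * a ^+ 2)^-1 * (Ceps * (enorm b * sin0 ^+ m)).
Proof.
move=> t0; set e := _ - _.
have c0 : 0 < t + rho * a ^+ 2.
  by rewrite ltr_wpDl// mulr_gt0 ?fov_inv_gt0// exprn_gt0// specnorm_gt0.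
rewrite [leRHS]mulrAC ler_pdivlMr// (le_trans (shift_resolvent_bound n_gt0 hA e t0))//.
rewrite ler_wpM2l ?specnorm_ge0// /e mulmxBr mulKVmx ?shift_unit//.
exact: sketched_residual.
Qed.

(** Supplies the decay in [t] needed for integrability. A left inverse [W] of [V] recovers [y] from
    [V y], and [M t y] is a projection of [c], hence no longer than [c]. *)
Lemma sketched_pinv_bound t (c : 'cV_s) (W : 'M[C]_(m, n)) : 0 <= t -> W *m V = 1%:M ->
  enorm (mpinv (M t) *m c)
  <= specnorm W / Num.sqrt (1 - eps) / (t + delta) * enorm c.
Proof.
move=> t0 WV; set y := mpinv (M t) *m c.
have td0 : 0 < t + delta by rewrite ltr_wpDl// fov_gt0.
have h1 := enorm_mulmx W (V *m y); rewrite mulmxA WV mul1mx in h1.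
apply: (le_trans h1); rewrite -!mulrA ler_wpM2l ?specnorm_ge0//.
rewrite mulrA -invfM mulrC ler_pdivlMr ?mulr_gt0// mulrC.
apply: le_trans (sketch_mulmx_lower y t0) _.
exact: (enorm_mpinv_proj (fun y => @sketch_inj t y t0)).
Qed.

End SketchedGmres.

(** * Integrals of matrix-valued functions *)

Section ComplexMeasurable.
Context d (T : measurableType d) (R : realType) (D : set T).
Local Notation C := R[i].
Implicit Types f g : T -> C.

(** Inversion is continuous off [0] but not at [0], where its value is [0]; the point is split
    off. *)
Lemma measurable_inv : measurable_fun [set: R] (@GRing.inv R).
Proof.
rewrite -(setUv [set 0 : R]); apply/measurable_funU => //.
  exact: measurableC.
split; first exact: measurable_fun_set1.
apply: open_continuous_measurable_fun.
  by apply: closed_openC; exact: closed_eq.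
by move=> x; rewrite inE /= => /eqP x0; exact: inv_continuous.
Qed.

Definition cmeasurable f :=
  measurable_fun D (fun t => Re (f t)) /\ measurable_fun D (fun t => Im (f t)).

Lemma cmeasurable_cst z : cmeasurable (fun=> z).
Proof. by split; exact: measurable_cst. Qed.

Lemma cmeasurableD f g :
  cmeasurable f -> cmeasurable g -> cmeasurable (fun t => f t + g t).
Proof.
move=> [fr fi] [gr gi]; split.
  under eq_fun do rewrite ReD; exact: measurable_funD.
under eq_fun do rewrite ImD; exact: measurable_funD.
Qed.

Lemma cmeasurableM f g :
  cmeasurable f -> cmeasurable g -> cmeasurable (fun t => f t * g t).
Proof.
move=> [fr fi] [gr gi]; split.
  under eq_fun do rewrite ReM.
  by apply: measurable_funB; exact: measurable_funM.
under eq_fun do rewrite ImM.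
by apply: measurable_funD; exact: measurable_funM.
Qed.

Lemma cmeasurable_conj f : cmeasurable f -> cmeasurable (fun t => Num.conj (f t)).
Proof.
have Re_conj (z : C) : Re (Num.conj z) = Re z by case: z.
have Im_conj (z : C) : Im (Num.conj z) = - Im z by case: z.
move=> [fr fi]; split; first by under eq_fun do rewrite Re_conj.
by under eq_fun do rewrite Im_conj; exact: measurable_funN.
Qed.

Lemma cmeasurableV f : cmeasurable f -> cmeasurable (fun t => (f t)^-1).
Proof.
move=> [fr fi].
have m2 : measurable_fun D (fun t => (Re (f t) ^+ 2 + Im (f t) ^+ 2)^-1).
  apply: (measurableT_comp measurable_inv).
  by apply: measurable_funD; exact: measurable_funX.
have Re_inv (z : C) : Re z^-1 = Re z * (Re z ^+ 2 + Im z ^+ 2)^-1 by case: z.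
have Im_inv (z : C) : Im z^-1 = - (Im z * (Re z ^+ 2 + Im z ^+ 2)^-1) by case: z.
split; first by under eq_fun do rewrite Re_inv; exact: measurable_funM.
by under eq_fun do rewrite Im_inv; apply: measurable_funN; exact: measurable_funM.
Qed.

Lemma cmeasurable_sum I (r : seq I) (P : pred I) (F : I -> T -> C) :
  (forall i, cmeasurable (F i)) -> cmeasurable (fun t => \sum_(i <- r | P i) F i t).
Proof.
move=> hF; elim: r => [|i r IH].
  by under eq_fun do rewrite big_nil; exact: cmeasurable_cst.
under eq_fun do rewrite big_cons.
by case: (P i) => //; exact: cmeasurableD.
Qed.

Lemma cmeasurable_prod I (r : seq I) (P : pred I) (F : I -> T -> C) :
  (forall i, cmeasurable (F i)) -> cmeasurable (fun t => \prod_(i <- r | P i) F i t).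
Proof.
move=> hF; elim: r => [|i r IH].
  by under eq_fun do rewrite big_nil; exact: cmeasurable_cst.
under eq_fun do rewrite big_cons.
by case: (P i) => //; exact: cmeasurableM.
Qed.

Definition mxmeasurable m n (F : T -> 'M[C]_(m, n)) :=
  forall i j, cmeasurable (fun t => F t i j).

Lemma mxmeasurable_cst m n (M : 'M[C]_(m, n)) : mxmeasurable (fun=> M).
Proof. by move=> i j; exact: cmeasurable_cst. Qed.

Lemma mxmeasurableD m n (F G : T -> 'M[C]_(m, n)) :
  mxmeasurable F -> mxmeasurable G -> mxmeasurable (fun t => F t + G t).
Proof. by move=> hF hG i j; under eq_fun do rewrite mxE; exact: cmeasurableD. Qed.

Lemma mxmeasurableZ m n (f : T -> C) (F : T -> 'M[C]_(m, n)) :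
  cmeasurable f -> mxmeasurable F -> mxmeasurable (fun t => f t *: F t).
Proof. by move=> hf hF i j; under eq_fun do rewrite mxE; exact: cmeasurableM. Qed.

Lemma mxmeasurableM m n p (F : T -> 'M[C]_(m, n)) (G : T -> 'M[C]_(n, p)) :
  mxmeasurable F -> mxmeasurable G -> mxmeasurable (fun t => F t *m G t).
Proof.
move=> hF hG i j; under eq_fun do rewrite mxE.
by apply: cmeasurable_sum => k; exact: cmeasurableM.
Qed.

Lemma mxmeasurable_adj m n (F : T -> 'M[C]_(m, n)) :
  mxmeasurable F -> mxmeasurable (fun t => (F t)^t*).
Proof. by move=> hF i j; under eq_fun do rewrite !mxE; exact: cmeasurable_conj. Qed.

Lemma cmeasurable_det n (F : T -> 'M[C]_n) :
  mxmeasurable F -> cmeasurable (fun t => \det (F t)).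
Proof.
move=> hF; apply: cmeasurable_sum => s; apply: cmeasurableM.
  exact: cmeasurable_cst.
by apply: cmeasurable_prod => i; exact: hF.
Qed.

Lemma eq_cmeasurable f g :
  (forall t, D t -> f t = g t) -> cmeasurable f -> cmeasurable g.
Proof.
move=> fg [fr fi]; split; [apply: eq_measurable_fun fr|apply: eq_measurable_fun fi];
  by move=> t; rewrite inE => /fg ->.
Qed.

Lemma eq_mxmeasurable m n (F G : T -> 'M[C]_(m, n)) :
  (forall t, D t -> F t = G t) -> mxmeasurable F -> mxmeasurable G.
Proof. by move=> FG hF i j; apply: eq_cmeasurable (hF i j) => t /FG ->. Qed.

(** Cramer's formula expresses the entries through determinants, which are polynomials in the
    entries of [F t]. It agrees with [invmx] where [F t] is invertible. *)
Lemma mxmeasurable_inv n (F : T -> 'M[C]_n) : mxmeasurable F ->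
  (forall t, D t -> F t \in unitmx) -> mxmeasurable (fun t => invmx (F t)).
Proof.
move=> hF uF; apply: (@eq_mxmeasurable _ _ (fun t => (\det (F t))^-1 *: \adj (F t))).
  by move=> t /uF uFt; rewrite /invmx uFt.
apply: mxmeasurableZ; first exact/cmeasurableV/cmeasurable_det.
move=> i j; under eq_fun do rewrite mxE.
apply: cmeasurableM; first exact: cmeasurable_cst.
apply: cmeasurable_det => k l; under eq_fun do rewrite !mxE; exact: hF.
Qed.

End ComplexMeasurable.

(** * Integration against the Stieltjes measure *)

Section StieltjesIntegral.
Variables (R : realType) (mu : stieltjes_weight R).
Local Notation C := R[i].
Local Notation D := (`[0%R, +oo[%classic : set R).
Local Notation nu := (stieltjes_measure mu).

Definition rintegrable (h : R -> R) := nu.-integrable D (EFin \o h).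

Let mD : measurable (D : set (measurableTypeR R)).
Proof. exact: measurable_itv. Qed.

Lemma rintegrable_dominated c (h : R -> R) : stieltjes_integrable mu ->
  measurable_fun (D : set (measurableTypeR R)) h ->
  (forall t, 0 <= t -> `|h t| <= c * (t + 1)^-1) -> rintegrable h.
Proof.
move=> hmu mh hh.
have int1 : rintegrable (fun t => (t + 1)^-1).
  apply/integrableP; split.
    apply/measurable_EFinP; apply: (measurableT_comp (@measurable_inv R)).
    by apply: measurable_funD; [exact: measurable_id|exact: measurable_cst].
  apply: le_lt_trans hmu; rewrite le_eqVlt; apply/orP; left; apply/eqP.
  apply: eq_integral => t; rewrite inE /= in_itv /= andbT => t0.
  by rewrite ger0_norm// invr_ge0 addr_ge0.
apply: (@le_integrable _ _ _ nu _ mD _ (fun t => c%:E * ((t + 1)^-1)%:E)%E).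
- exact/measurable_EFinP.
- move=> t /=; rewrite in_itv /= andbT => t0; rewrite lee_fin.
  exact: le_trans (hh t t0) (ler_norm _).
- exact: integrableZl.
Qed.

Lemma rintegrableD f g :
  rintegrable f -> rintegrable g -> rintegrable (fun t => f t + g t).
Proof. exact: integrableD. Qed.

Lemma rintegrableZ c f : rintegrable f -> rintegrable (fun t => c * f t).
Proof. exact: integrableZl. Qed.

Definition cintegrable (f : R -> C) :=
  rintegrable (fun t => Re (f t)) /\ rintegrable (fun t => Im (f t)).

Lemma cintegral_cst0 : cintegral mu (fun=> 0) = 0.
Proof. by rewrite /cintegral /Rintegral integral0. Qed.

Lemma cintegrableD f g : cintegrable f -> cintegrable g ->
  cintegrable (fun t => f t + g t).
Proof.
move=> [fr fi] [gr gi]; split.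
  by under eq_fun do rewrite ReD; exact: rintegrableD.
by under eq_fun do rewrite ImD; exact: rintegrableD.
Qed.

Lemma cintegralD f g : cintegrable f -> cintegrable g ->
  cintegral mu (fun t => f t + g t) = cintegral mu f + cintegral mu g.
Proof.
move=> [fr fi] [gr gi]; rewrite /cintegral.
have -> : (fun t => Re (f t + g t)) = (fun t => Re (f t) + Re (g t)).
  by apply/funext => t; rewrite ReD.
have -> : (fun t => Im (f t + g t)) = (fun t => Im (f t) + Im (g t)).
  by apply/funext => t; rewrite ImD.
by rewrite (RintegralD mD fr gr) (RintegralD mD fi gi).
Qed.

Lemma cintegrableZ z f : cintegrable f -> cintegrable (fun t => z * f t).
Proof.
move=> [fr fi]; split.
  rewrite (_ : (fun _ => _) = (fun t => Re z * Re (f t) + - Im z * Im (f t))).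
    by apply: rintegrableD; exact: rintegrableZ.
  by apply/funext => t; rewrite ReM mulNr.
under eq_fun do rewrite ImM.
by apply: rintegrableD; exact: rintegrableZ.
Qed.

Lemma cintegralZ z f : cintegrable f ->
  cintegral mu (fun t => z * f t) = z * cintegral mu f.
Proof.
move=> [fr fi]; rewrite /cintegral.
have -> : (fun t => Re (z * f t)) = (fun t => Re z * Re (f t) + - Im z * Im (f t)).
  by apply/funext => t; rewrite ReM mulNr.
have -> : (fun t => Im (z * f t)) = (fun t => Re z * Im (f t) + Im z * Re (f t)).
  by apply/funext => t; rewrite ImM.
rewrite (RintegralD mD); [|exact: rintegrableZ..].
rewrite (RintegralD mD); [|exact: rintegrableZ..].
rewrite !(RintegralZl _ mD)//.
by case: z => x y /=; rewrite mulNr.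
Qed.

Lemma cintegrable_sum I (r : seq I) (F : I -> R -> C) :
  (forall i, cintegrable (F i)) -> cintegrable (fun t => \sum_(i <- r) F i t).
Proof.
move=> hF; elim: r => [|i r IH].
  under eq_fun do rewrite big_nil.
  by split; exact: integrable0.
by under eq_fun do rewrite big_cons; exact: cintegrableD.
Qed.

Lemma cintegral_sum I (r : seq I) (F : I -> R -> C) :
  (forall i, cintegrable (F i)) ->
  cintegral mu (fun t => \sum_(i <- r) F i t) = \sum_(i <- r) cintegral mu (F i).
Proof.
move=> hF; elim: r => [|i r IH].
  by under eq_fun do rewrite big_nil; rewrite big_nil cintegral_cst0.
under eq_fun do rewrite big_cons.
by rewrite big_cons cintegralD ?IH//; exact: cintegrable_sum.
Qed.

Definition mxintegrable m n (G : R -> 'M[C]_(m, n)) :=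
  forall i j, cintegrable (fun t => G t i j).

Lemma mxintegrable_mull m n p (P : 'M[C]_(m, n)) (G : R -> 'M[C]_(n, p)) :
  mxintegrable G -> mxintegrable (fun t => P *m G t).
Proof.
move=> hG i j; under eq_fun do rewrite mxE.
by apply: cintegrable_sum => k; exact: cintegrableZ.
Qed.

Lemma mxintegral_mull m n p (P : 'M[C]_(m, n)) (G : R -> 'M[C]_(n, p)) :
  mxintegrable G -> mxintegral mu (fun t => P *m G t) = P *m mxintegral mu G.
Proof.
move=> hG; apply/matrixP => i j; rewrite !mxE.
under eq_fun do rewrite mxE.
rewrite cintegral_sum; last by move=> k; exact: cintegrableZ.
by apply: eq_bigr => k _; rewrite cintegralZ// mxE.
Qed.

Lemma mxintegrable_mulr m n p (G : R -> 'M[C]_(m, n)) (Q : 'M[C]_(n, p)) :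
  mxintegrable G -> mxintegrable (fun t => G t *m Q).
Proof.
move=> hG i j; under eq_fun do rewrite mxE.
by apply: cintegrable_sum => k; under eq_fun do rewrite mulrC; exact: cintegrableZ.
Qed.

Lemma mxintegral_mulr m n p (G : R -> 'M[C]_(m, n)) (Q : 'M[C]_(n, p)) :
  mxintegrable G -> mxintegral mu (fun t => G t *m Q) = mxintegral mu G *m Q.
Proof.
move=> hG; apply/matrixP => i j; rewrite !mxE.
under eq_fun do rewrite mxE.
rewrite cintegral_sum; last first.
  by move=> k; under eq_fun do rewrite mulrC; exact: cintegrableZ.
apply: eq_bigr => k _; under eq_fun do rewrite mulrC.
by rewrite cintegralZ// mxE mulrC.
Qed.

Lemma mxintegrableB m n (F G : R -> 'M[C]_(m, n)) :
  mxintegrable F -> mxintegrable G -> mxintegrable (fun t => F t - G t).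
Proof.
move=> hF hG i j; under eq_fun do rewrite !mxE -mulN1r.
by apply: cintegrableD => //; exact: cintegrableZ.
Qed.

Lemma mxintegralB m n (F G : R -> 'M[C]_(m, n)) :
  mxintegrable F -> mxintegrable G ->
  mxintegral mu (fun t => F t - G t) = mxintegral mu F - mxintegral mu G.
Proof.
move=> hF hG; apply/matrixP => i j; rewrite !mxE.
under eq_fun do rewrite !mxE -mulN1r.
by rewrite cintegralD// ?cintegralZ// ?mulN1r//; exact: cintegrableZ.
Qed.

(** Pair the integral [x] with itself: [|x|^2] is the integral of [rdot x (G t)], which
    Cauchy-Schwarz bounds by [|x|] times the integral of [g]; then cancel [|x|]. *)
Lemma enorm_mxintegral n (G : R -> 'cV[C]_n) (g : R -> R) :
  mxintegrable G -> rintegrable g ->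
  (forall t, 0 <= t -> enorm (G t) <= g t) ->
  enorm (mxintegral mu G) <= Rintegral nu D g.
Proof.
move=> hG hg Gg; set x := mxintegral mu G.
have Ige0 : 0 <= Rintegral nu D g.
  apply: Rintegral_ge0 => t /=; rewrite in_itv /= andbT => t0.
  exact: le_trans (enorm_ge0 _) (Gg t t0).
have [->|x0] := eqVneq x 0; first by rewrite enorm0.
rewrite -enorm_gt0 in x0; rewrite -(ler_pM2l x0) -expr2 sqr_enorm.
rewrite {2}/x /rdot -mxintegral_mull// mxE /= -(RintegralZl _ mD hg).
apply: (le_Rintegral mD).
- by case: (mxintegrable_mull (x^t*) hG 0 0).
- exact: rintegrableZ.
- move=> t /=; rewrite in_itv /= andbT => t0.
  rewrite -/(rdot x (G t)); apply: le_trans (rdot_le _ _) _.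
  by rewrite ler_pM2l// Gg.
Qed.

Lemma mxintegrable_dominated m n c (G : R -> 'M[C]_(m, n)) :
  stieltjes_integrable mu ->
  mxmeasurable (D : set (measurableTypeR R)) G ->
  (forall t v, 0 <= t -> enorm (G t *m v) <= c * (t + 1)^-1 * enorm v) ->
  mxintegrable G.
Proof.
move=> hmu mG hG i j; pose v : 'cV[C]_n := delta_mx j 0.
(* An operator bound suffices, since each entry is a coordinate of [G t] applied to a unit
   vector. *)
have entry t : G t i j = (G t *m v) i 0 by rewrite -colE mxE.
have bound t : 0 <= t -> `|Re (G t i j)| <= c * enorm v * (t + 1)^-1 /\
    `|Im (G t i j)| <= c * enorm v * (t + 1)^-1.
  move=> t0; rewrite entry mulrAC; have [h1 h2] := coord_le_enorm (G t *m v) i.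
  by split; [apply: le_trans h1 _|apply: le_trans h2 _]; exact: hG.
by have [mr mi] := mG i j; split;
  (apply: (@rintegrable_dominated (c * enorm v)) => // t /bound []).
Qed.

End StieltjesIntegral.

(** * The resolvent and the sketched pseudoinverse under the integral *)

Section StieltjesResolvent.
Variables (R : realType) (mu : stieltjes_weight R).
Hypothesis hmu : stieltjes_integrable mu.
Local Notation C := R[i].
Local Notation D := (`[0%R, +oo[%classic : set R).
Local Notation nu := (stieltjes_measure mu).

(** The constant covers small and large [c] at once: [(1 + 1/c) (t + c) = (t + 1) + (c + t/c)]. *)
Lemma shift_inv_le (c t : R) : 0 < c -> 0 <= t ->
  (t + c)^-1 <= (1 + c^-1) * (t + 1)^-1.
Proof.
move=> c0 t0; have c1 := ltW c0; rewrite ler_pdivlMr ?ltr_wpDl// mulrC ler_pdivrMr ?ltr_wpDl//.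
rewrite mulrDl mul1r mulrDr mulVf ?gt_eqF// addrA lerD2r -addrA lerDl.
by rewrite addr_ge0 ?mulr_ge0 ?invr_ge0.
Qed.

Lemma rintegrable_shift_inv (c : R) : 0 < c ->
  rintegrable mu (fun t => (t + c)^-1).
Proof.
move=> c0; apply: (@rintegrable_dominated _ _ (1 + c^-1)) => //.
  apply: (measurableT_comp (@measurable_inv R)).
  by apply: measurable_funD; [exact: measurable_id|exact: measurable_cst].
move=> t t0; rewrite ger0_norm ?shift_inv_le//.
by rewrite invr_ge0 addr_ge0 ?(ltW c0).
Qed.

(** Shows that the value of [f] in [C1] is real and equals the integral of the pointwise bound. *)
Lemma cintegral_real_shift_inv (c : R) :
  cintegral mu (fun t => (t%:C + c%:C)^-1)
  = (Rintegral nu D (fun t => (t + c)^-1))%:C.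
Proof.
rewrite /cintegral.
have E t : (t%:C + c%:C)^-1 = ((t + c)^-1)%:C :> C by rewrite -rmorphD fmorphV.
have -> : (fun t => Re (t%:C + c%:C)^-1) = (fun t => (t + c)^-1).
  by apply/funext => t; rewrite E.
have -> : (fun t => Im (t%:C + c%:C)^-1) = cst 0.
  by apply/funext => t; rewrite E.
by rewrite {2}/Rintegral integral0.
Qed.

Lemma cmeasurable_id : cmeasurable (D : set (measurableTypeR R)) (fun t => t%:C).
Proof. by split; [exact: measurable_id|exact: measurable_cst]. Qed.

Variables (n m s : nat) (A : 'M[C]_n) (b : 'cV[C]_n) (eps : R).
Variables (S : 'M[C]_(s, n)) (V : 'M[C]_(n, m)).
Hypotheses (n_gt0 : (0 < n)%N) (hA : positive_real A) (heps : 0 <= eps < 1).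
Hypothesis hS : forall v : 'cV[C]_n, v \in krylov A b m.+1 ->
  (1 - eps) * enorm v ^+ 2 <= enorm (S *m v) ^+ 2 <= (1 + eps) * enorm v ^+ 2.
Hypothesis hV : basis_of (krylov A b m) [seq col j V | j : 'I_m].

Local Notation delta := (lambda_min (herm_part A)).
Local Notation rho := (lambda_min (herm_part (invmx A))).
Local Notation a := (specnorm A).
Local Notation sin0 := (Num.sqrt (1 - (delta / a) ^+ 2)).
Local Notation Ceps := (Num.sqrt ((1 + eps) / (1 - eps))).
Local Notation M t := (t%:C *: (S *m V) + S *m A *m V).

Let DE t : D t -> 0 <= t.
Proof. by rewrite /= in_itv /= andbT. Qed.

Lemma mxintegrable_resolvent : mxintegrable mu (fun t => invmx (t%:C%:M + A)).
Proof.
apply: (@mxintegrable_dominated _ _ _ _ (1 + delta^-1)) => //.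
  apply: mxmeasurable_inv => [|t /DE t0]; last exact: shift_unit.
  apply: mxmeasurableD; last exact: mxmeasurable_cst.
  apply: (@eq_mxmeasurable _ _ _ _ _ _ (fun t : measurableTypeR R => t%:C *: 1%:M)).
    by move=> t _; rewrite scalemx1.
  by apply: mxmeasurableZ; [exact: cmeasurable_id|exact: mxmeasurable_cst].
(* The decay comes from [shift_lower] at the vector [(t + A)^-1 v]. *)
move=> t v t0; have d0 := fov_gt0 n_gt0 hA.
apply: (@le_trans _ _ ((t + delta)^-1 * enorm v)); last first.
  by rewrite ler_wpM2r ?enorm_ge0// shift_inv_le.
rewrite mulrC ler_pdivlMr ?ltr_wpDl// mulrC.
apply: le_trans (shift_lower n_gt0 hA t _) _.
by rewrite mulKVmx ?shift_unit.
Qed.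

Lemma mxintegrable_sketched_pinv : mxintegrable mu (fun t => mpinv (M t)).
Proof.
set K := specnorm (mpinv V) / Num.sqrt (1 - eps).
have K0 : 0 <= K by rewrite divr_ge0 ?specnorm_ge0 ?sqrtr_ge0.
have Minj t (t0 : 0 <= t) y := @sketch_inj _ _ _ _ _ _ _ _ _ n_gt0 hA heps hS hV t y t0.
apply: (@mxintegrable_dominated _ _ _ _ (K * (1 + delta^-1))) => //.
  have mM : mxmeasurable (D : set (measurableTypeR R)) (fun t => M t).
    apply: mxmeasurableD; last exact: mxmeasurable_cst.
    apply: mxmeasurableZ; [exact: cmeasurable_id|exact: mxmeasurable_cst].
  have mMH := mxmeasurable_adj mM.
  apply: (@eq_mxmeasurable _ _ _ _ _ _
            (fun t : measurableTypeR R => invmx ((M t)^t* *m M t) *m (M t)^t*)).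
    by move=> t /DE t0; rewrite mpinvE//; exact: Minj.
  apply: mxmeasurableM => //; apply: mxmeasurable_inv; first exact: mxmeasurableM.
  by move=> t /DE t0; apply: gram_unit; exact: Minj.
move=> t v t0; have d0 := fov_gt0 n_gt0 hA.
(* The columns of [V] are independent, so [mpinv V] is a left inverse of [V]. *)
have WV : mpinv V *m V = 1%:M by apply: mpinvK; exact: krylov_basis_inj hV.
apply: le_trans (sketched_pinv_bound n_gt0 hA heps hS hV v t0 WV) _.
by rewrite -/K ler_wpM2r ?enorm_ge0// -[leRHS]mulrA ler_wpM2l// shift_inv_le.
Qed.

Lemma enorm_sketched_error :
  enorm (A *m (stieltjes_mx mu A b - sketched_gmres mu A b S V))
  <= a * Rintegral nu D (fun t => (t + rho * a ^+ 2)^-1)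
     * (Ceps * enorm b * sin0 ^+ m).
Proof.
have r0 : 0 < rho * a ^+ 2.
  by rewrite mulr_gt0 ?fov_inv_gt0// exprn_gt0// specnorm_gt0.
have hF := mxintegrable_mulr b mxintegrable_resolvent.
have hP := mxintegrable_sketched_pinv.
have hG := mxintegrable_mull V (mxintegrable_mulr (S *m b) hP).
have -> : A *m (stieltjes_mx mu A b - sketched_gmres mu A b S V) =
  mxintegral mu (fun t => A *m (invmx (t%:C%:M + A) *m b
                                - V *m (mpinv (M t) *m (S *m b)))).
  rewrite mxintegral_mull; last exact: mxintegrableB.
  rewrite mxintegralB// mxintegral_mull; last exact: mxintegrable_mulr.
  by rewrite [in RHS](mxintegral_mulr (S *m b) hP) mulmxA.
(* The part of the pointwise bound that does not depend on [t]. *)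
pose k := a * (Ceps * (enorm b * sin0 ^+ m)).
have kint := rintegrableZ k (rintegrable_shift_inv r0).
apply: le_trans (enorm_mxintegral _ kint _) _.
- by apply: mxintegrable_mull; exact: mxintegrableB.
- move=> t t0; apply: le_trans (sketched_error n_gt0 hA heps hS hV t0) _.
  by rewrite mulrAC.
- rewrite RintegralZl//; last exact: rintegrable_shift_inv.
  rewrite /k; move: (Rintegral _ _ _) (sin0 ^+ m) (enorm b) Ceps => I x y z.
  by rewrite [leLHS]mulrAC (mulrA z).
Qed.

End StieltjesResolvent.

Lemma wnorm_adj (R : realType) n (A : 'M[R[i]]_n) v :
  wnorm (A^t* *m A) v = enorm (A *m v).
Proof. by rewrite /wnorm /enorm trmx_mul map_mxM !mulmxA. Qed.

Unset Implicit Arguments.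

Theorem theorem3p3 (R : realType) (N m s : nat) (hN : (0 < N)%N)
  (A : 'M[R[i]]_N) (hA : positive_real A) (b : 'cV[R[i]]_N)
  (mu : stieltjes_weight R) (f : R[i] -> R[i]) (hf : stieltjes_function mu f)
  (eps : R) (heps : 0 <= eps < 1)
  (S : 'M[R[i]]_(s, N))
  (hS : forall v : 'cV[R[i]]_N, v \in krylov A b m.+1 ->
     (1 - eps) * enorm v ^+ 2 <= enorm (S *m v) ^+ 2
       <= (1 + eps) * enorm v ^+ 2)
  (V : 'M[R[i]]_(N, m))
  (hV : basis_of (krylov A b m) [seq col j V | j : 'I_m]) :
  let delta := lambda_min (herm_part A) in
  let rho := lambda_min (herm_part (invmx A)) in
  let beta0 := acos (delta / specnorm A) in
  let C1 := (specnorm A)%:C * f (rho * specnorm A ^+ 2)%:C in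
  let Ceps := Num.sqrt ((1 + eps) / (1 - eps)) in
  0 <= beta0 < pi / 2 /\
  (wnorm (A^t* *m A)
     (stieltjes_mx mu A b - sketched_gmres mu A b S V))%:C
  <= C1 * (Ceps * enorm b * sin beta0 ^+ m)%:C.
Proof.
move=> delta rho beta0 C1 Ceps.
have /andP[q0 q1] := fov_ratio hN hA; rewrite -/delta in q0 q1.
have qN : -1 <= delta / specnorm A <= 1 by rewrite q1 andbT (le_trans _ (ltW q0)).
have b0 : 0 <= beta0 by exact: acos_ge0.
have c0 : 0 < rho * specnorm A ^+ 2.
  by rewrite mulr_gt0 ?fov_inv_gt0// exprn_gt0// specnorm_gt0.
split.
  (* Cosine decreases on [[0, pi]], so [beta0 < pi / 2] amounts to [0 < delta / |A|]. *)
  rewrite b0 /=; rewrite -ltr_cos ?in_itv /= ?b0 ?acos_lepi//; last first.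
    by rewrite divr_ge0 ?pi_ge0//= ler_pdivrMr// ler_peMr ?pi_ge0 ?ler1n.
  by rewrite cos_pihalf acosK ?in_itv.
have [hmu fE] := hf.
(* The integral formula for [f] applies because [rho |A|^2 > 0]. The right-hand side then becomes
   real, and the inequality in [R[i]] reduces to one in [R]. *)
rewrite wnorm_adj /C1 fE; last by rewrite (lecR _ 0) -ltNge.
rewrite cintegral_real_shift_inv -!rmorphM lecR sin_acos//.
exact: enorm_sketched_error.
Qed.
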